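(* Let $n$ be a positive integer with $n \leq 3$. Then stit logic has the Restricted $n$-Craig Interpolation Property $(RCIP)_n$: for every set of propositional variables $V$ and all $A, B \in \mathcal{L}^{\{1,\ldots,n\}}_V$, if $\vdash A \to B$ and $Ag(A) \cap Ag(B) = \emptyset$, then there exists $C \in \mathcal{L}^{Ag(A)\cup Ag(B)}_{|A|\cap|B|}$ such that $\vdash A \to C$ and $\vdash C \to B$.
   Context: For a finite set $Ag$ of agent indices and a set $V$ of propositional variables, $\mathcal{L}^{Ag}_V$ is the set of stit formulas given by $A ::= p \mid A \to A \mid \bot \mid \Box A \mid [j]A$ with $p \in V$, $j \in Ag$ (other Boolean connectives are defined as usual; $\Diamond A := \neg\Box\neg A$). $\Box$ is historical necessity and $[j]$ is the Chellas stit operator of agent $j$. $\vdash A$ means that $A$ is derivable in the axiom system $\mathbb{S}$ whose axioms are: all classical propositional tautologies; the S5 axioms for $\Box$ and for each $[j]$, $j\in Ag$; $\Box A \to [j]A$ for each $j$; and $(\Diamond[j_1]A_1 \wedge\dots\wedge \Diamond[j_k]A_k) \to \Diamond([j_1]A_1\wedge\dots\wedge[j_k]A_k)$ for pairwise distinct $j_1,\dots,j_k$; and whose rules are modus ponens and necessitation for $\Box$ (from $A$ infer $\Box A$). (This system is sound and strongly complete for the standard branching-time stit semantics.) For a formula $A$, $|A|$ is the set of propositional variables occurring in $A$ and $Ag(A)$ is the set of agent indices occurring in $A$. *)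

(* Defs.v *)
From mathcomp Require Import all_boot.

Set Implicit Arguments.
Unset Strict Implicit.
Unset Printing Implicit Defensive.

Inductive form (Ag : finType) (V : Type) : Type :=
| Var of V
| Imp of form Ag V & form Ag V
| Bot
| Box of form Ag V
| Stit of Ag & form Ag V.

Arguments Var {Ag V} _.
Arguments Imp {Ag V} _ _.
Arguments Bot {Ag V}.
Arguments Box {Ag V} _.
Arguments Stit {Ag V} _ _.

Section Stit.

Variables (Ag : finType) (V : Type).
Implicit Types (A B : form Ag V) (j : Ag).

Definition Neg A := Imp A Bot.
Definition And A B := Neg (Imp A (Neg B)).
Definition Dia A := Neg (Box (Neg A)).

(* A /\ A1 /\ ... /\ Ak for s = [:: A1; ...; Ak]. *)
Fixpoint Conj A (s : seq (form Ag V)) : form Ag V :=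
  if s is B :: s' then And A (Conj B s') else A.

Fixpoint agents A : {set Ag} :=
  match A with
  | Var _ | Bot => set0
  | Imp B C => agents B :|: agents C
  | Box B => agents B
  | Stit j B => j |: agents B
  end.

Fixpoint vars A : V -> Prop :=
  match A with
  | Var p => fun q => q = p
  | Imp B C => fun q => vars B q \/ vars C q
  | Bot => fun _ => False
  | Box B | Stit _ B => vars B
  end.

(* The sublanguage over the agents in X and the variables in W. *)
Fixpoint in_lang (X : {set Ag}) (W : V -> Prop) A : Prop :=
  match A with
  | Var p => W p
  | Imp B C => in_lang X W B /\ in_lang X W C
  | Bot => True
  | Box B => in_lang X W B
  | Stit j B => j \in X /\ in_lang X W B
  end.

(* Truth value of A when variables and modalized formulas are treated as
   propositional atoms, valued by v. *)
Fixpoint peval (v : form Ag V -> bool) A : bool :=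
  match A with
  | Imp B C => peval v B ==> peval v C
  | Bot => false
  | Var _ | Box _ | Stit _ _ => v A
  end.

Definition tautology A : Prop := forall v, peval v A.

Inductive S5_axiom (M : form Ag V -> form Ag V) : form Ag V -> Prop :=
| S5_K A B : S5_axiom M (Imp (M (Imp A B)) (Imp (M A) (M B)))
| S5_T A : S5_axiom M (Imp (M A) A)
| S5_4 A : S5_axiom M (Imp (M A) (M (M A)))
| S5_5 A : S5_axiom M (Imp (Neg (M A)) (M (Neg (M A)))).

Inductive derivable : form Ag V -> Prop :=
| ax_taut A : tautology A -> derivable A
| ax_Box A : S5_axiom Box A -> derivable A
| ax_Stit j A : S5_axiom (Stit j) A -> derivable A
| ax_Box_Stit j A : derivable (Imp (Box A) (Stit j A))
| ax_indep (a : Ag * form Ag V) (s : seq (Ag * form Ag V)) :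
    uniq [seq b.1 | b <- a :: s] ->
    derivable
      (Imp (Conj (Dia (Stit a.1 a.2)) [seq Dia (Stit b.1 b.2) | b <- s])
           (Dia (Conj (Stit a.1 a.2) [seq Stit b.1 b.2 | b <- s])))
| rule_MP A B : derivable (Imp A B) -> derivable A -> derivable B
| rule_Nec A : derivable A -> derivable (Box A).

End Stit.

(* The agents 1, ..., n are represented by the elements of 'I_n. *)
Definition RCIP (n : nat) : Prop :=
  forall (V : Type) (A B : form 'I_n V),
    derivable (Imp A B) ->
    agents A :&: agents B = set0 ->
    exists C : form 'I_n V,
      [/\ in_lang (agents A :|: agents B) (fun p => vars A p /\ vars B p) C,
          derivable (Imp A C) & derivable (Imp C B)].

(* Main.v *)
Require Import Defs.
From mathcomp Require Import all_boot.
From mathcomp Require Import boolp.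
From mathcomp Require classical_sets.

Set Implicit Arguments.
Unset Strict Implicit.
Unset Printing Implicit Defensive.

(** With at most three agents, one of two formulas with disjoint agent sets,
    say A, has at most one agent; let L be the language over the agents of A
    and the common variables.  If no formula of L interpolates A -> B, there
    are maximal consistent sets w containing A and v containing ~ B that agree
    on L.  Consider the pairs (m, n) of maximal consistent sets agreeing on L,
    with m and n in the historical classes of w and v, where the agents of A
    act through m and all the other agents through n.  Agreement on L is a
    bisimulation of canonical models, so m decides the formulas of the
    language of A and n those of the language of B; hence A -> B fails at
    (w, v).  Independence holds for the pairs since independence in the second
    component can be transferred to the first along the bisimulation for the
    single agent of A (with two such agents this would break down). *)

(** * Single-moment stit models and soundness *)

Section Semantics.

Variables (Ag : finType) (V W : Type).
Variables (R : Ag -> W -> W -> Prop) (val : V -> W -> Prop).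

(* Box is the universal modality: a model is a single moment. *)
Fixpoint sat (A : form Ag V) (w : W) : Prop :=
  match A with
  | Var p => val p w
  | Imp B C => sat B w -> sat C w
  | Bot => False
  | Box B => forall u, sat B u
  | Stit j B => forall u, R j w u -> sat B u
  end.

Hypotheses (R_refl : forall j w, R j w w)
  (R_sym : forall j w u, R j w u -> R j u w)
  (R_trans : forall j w u t, R j w u -> R j u t -> R j w t)
  (R_indep : forall f : Ag -> W, exists w, forall j, R j (f j) w).

Lemma sat_peval (w : W) A : peval (fun B => `[< sat B w >]) A <-> sat A w.
Proof.
elim: A => [p|A IHA B IHB||A _|j A _] /=; try by split=> /asboolP.
- split=> [/implyP h /IHA/h/IHB //|h]; apply/implyP => /IHA/h; exact: (proj2 IHB).
- by [].
Qed.

Lemma sat_And A B w : sat (And A B) w <-> sat A w /\ sat B w.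
Proof.
split=> /= [h|[hA hB] h]; last exact: h.
by split; apply: contrapT => hn; apply: h => // ? ?; apply: hn.
Qed.

Lemma sat_Dia A w : sat (Dia A) w <-> exists u, sat A u.
Proof.
split=> /= [h|[u hu] h]; last exact: (h u hu).
by apply: contrapT => hn; apply: h => u hu; apply: hn; exists u.
Qed.

(** Each diamond yields a witness for its own agent; distinctness of the agents lets one function
    [f] collect them without clashes. *)
Lemma sat_indep (a : Ag * form Ag V) s w :
  uniq [seq b.1 | b <- a :: s] ->
  sat (Conj (Dia (Stit a.1 a.2)) [seq Dia (Stit b.1 b.2) | b <- s]) w ->
  exists f : Ag -> W, forall u,
    (forall j, j \in [seq b.1 | b <- a :: s] -> R j (f j) u) ->
    sat (Conj (Stit a.1 a.2) [seq Stit b.1 b.2 | b <- s]) u.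
Proof.
elim: s a => [|b s IHs] a.
  move=> _ /sat_Dia[t ht]; exists (fun=> t) => u hu /= z uz; apply: ht.
  by apply: R_trans uz; apply: hu; rewrite mem_seq1.
rewrite [X in uniq X]/= cons_uniq => /andP[a_notin uniq_bs].
move=> /sat_And[/sat_Dia[t ht]] /(IHs b uniq_bs)[f hf].
exists (fun j => if j == a.1 then t else f j) => u hu.
apply/sat_And; split.
  move=> z uz; apply: ht; apply: R_trans uz.
  by have := hu a.1; rewrite eqxx; apply; rewrite mem_head.
apply: hf => j j_in; have := hu j; case: eqP => [ja|_].
  by move: a_notin; rewrite -ja j_in.
by apply; rewrite inE j_in orbT.
Qed.

Lemma soundness A : derivable A -> forall w, sat A w.
Proof.
elim=> {A} [A taut_A|A ax|j A ax|j A|a s uniq_as|A B _ IHAB _ IHA|A _ IHA] w.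
- by apply/sat_peval.
- case: ax => /= {}A => [B h hA u|//|//|nA u hA]; first exact: h.
  exact: nA.
- case: ax => /= {}A => [B h hA u wu|h|h u wu t ut|nA u wu hA].
  + by apply: h => //; apply: hA.
  + exact: h.
  + by apply: h; apply: R_trans ut.
  + by apply: nA => t wt; apply: hA; apply: R_trans wt; apply: R_sym.
- by move=> h u _; apply: h.
- move=> /(sat_indep uniq_as)[f hf]; have [u hu] := R_indep f.
  by apply/sat_Dia; exists u; apply: hf => j _; apply: hu.
- exact: IHAB (IHA w).
- by move=> u; apply: IHA.
Qed.

End Semantics.

Ltac tautology :=
  apply: ax_taut => ? /=;
  repeat match goal with |- context [peval ?v ?A] => case: (peval v A) end;
  done.

(** * Entailment and maximal consistent sets *)

Section Canonical.

Variables (Ag : finType) (V : Type).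
Local Notation form := (form Ag V).
Implicit Types (A B C D : form) (G m n : form -> Prop) (M : form -> form).

(** Necessitation applies to theorems only, never to hypotheses; this makes the deduction theorem
    hold. *)
Inductive entails G : form -> Prop :=
| entails_hyp A : G A -> entails G A
| entails_thm A : derivable A -> entails G A
| entails_mp A B : entails G (Imp A B) -> entails G A -> entails G B.

Lemma entails_mono G G' A :
  (forall B, G B -> G' B) -> entails G A -> entails G' A.
Proof.
move=> sub; elim=> {A} [A /sub|A|A B _ hAB _]; first exact: entails_hyp.
- exact: entails_thm.
- exact: entails_mp hAB.
Qed.

Lemma entails_thm_mp G A B : derivable (Imp A B) -> entails G A -> entails G B.
Proof. by move=> /(entails_thm G); apply: entails_mp. Qed.

(** A derivation uses finitely many members of [G2], and closure under conjunction merges them into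
    one; nonemptiness supplies [D] when none is used. *)
Lemma entails_split G1 G2 A :
  (exists D, G2 D) -> (forall C D, G2 C -> G2 D -> G2 (And C D)) ->
  entails (fun B => G1 B \/ G2 B) A -> exists2 D, G2 D & entails G1 (Imp D A).
Proof.
move=> [D0 hD0] closed; elim=> {A} [A [hA|hA]|A hA|A B _ [C hC hCA] _ [D hD hDB]].
- exists D0 => //; apply: (@entails_thm_mp _ A); first tautology.
  exact: entails_hyp.
- by exists A => //; apply: entails_thm; tautology.
- exists D0 => //; apply: (@entails_thm_mp _ A); first tautology.
  exact: entails_thm.
- exists (And C D); first exact: closed.
  apply: entails_mp hDB; apply: entails_thm_mp hCA.
  tautology.
Qed.

Lemma deduction A B : entails (eq A) B -> derivable (Imp A B).
Proof.
elim=> {B} [_ <-|B hB|B C _ hBC _ hB]; first tautology.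
- by apply: rule_MP hB; tautology.
- by apply: rule_MP hB; apply: rule_MP hBC; tautology.
Qed.

(** Maximality is encoded by commuting with implication: with [Bot] as consequent, [m] contains
    exactly one of [A] and [Neg A]. *)
Definition mcs m : Prop :=
  [/\ forall A, derivable A -> m A,
      forall A B, m (Imp A B) <-> (m A -> m B) &
      ~ m Bot].

Lemma Lindenbaum G :
  ~ entails G Bot -> exists2 m, mcs m & forall A, G A -> m A.
Proof.
move=> consG.
pose P X := ~ entails (fun A => X A \/ G A) Bot.
have [F FP Ftot|X [PX Xmax]] := @classical_sets.Zorn_bigcup form P.
  (* A derivation from the union of the chain already lives in one member; the first alternative
     covers those using [G] alone, in particular for the empty chain. *)
  have chain A :
      entails (fun B => classical_sets.bigcup F id B \/ G B) A ->
      entails G A \/ exists2 X, F X & entails (fun B => X B \/ G B) A.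
    elim=> {A} [A [[X FX XA]|GA]|A hA|A B _ IHAB _ IHA].
    - by right; exists X => //; apply: entails_hyp; left.
    - by left; apply: entails_hyp.
    - by left; apply: entails_thm.
    - have weaken X C : entails G C -> entails (fun B => X B \/ G B) C.
        by apply: entails_mono => ? ?; right.
      case: IHAB IHA => [hAB|[X FX hAB]] [hA|[Y FY hA]].
      + by left; apply: entails_mp hA.
      + by right; exists Y => //; apply: entails_mp hA; apply: weaken.
      + by right; exists X => //; apply: entails_mp hAB _; apply: weaken.
      + right; case: (Ftot X Y FX FY) => sub.
          exists Y => //; apply: entails_mp hA; apply: entails_mono hAB => C.
          by case=> [/sub|]; [left|right].
        exists X => //; apply: entails_mp hAB _; apply: entails_mono hA => C.
        by case=> [/sub|]; [left|right].
  by move=> /chain[//|[X /FP]].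
pose m := entails (fun A => X A \/ G A).
have m_max A : ~ m A -> m (Neg A).
  move=> nA; apply: contrapT => nNA.
  have := Xmax (fun B => X B \/ B = A); apply.
    split=> [B XB|sub]; first by left.
    by apply: nA; apply: entails_hyp; left; apply: sub; right.
  move=> h; apply: nNA.
  (* By maximality of [X], adding [A] is inconsistent. Replacing [A] by all its consequences gives a
     conjunction-closed set. *)
  have [|||D hAD hD] := @entails_split (fun B => X B \/ G B)
      (fun D => derivable (Imp A D)) Bot.
  - by exists A; tautology.
  - by move=> C D hC hD; apply: rule_MP hD; apply: rule_MP hC; tautology.
  - apply: entails_mono h => B [[XB|->]|GB]; [by left; left| |by left; right].
    by right; tautology.
  - apply: entails_mp hD; apply: entails_thm.
    by apply: rule_MP hAD; tautology.
exists m; last by move=> A GA; apply: entails_hyp; right.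
split=> // [A|A B]; first exact: entails_thm.
split=> [|h]; first exact: entails_mp.
case: (EM (m A)) => [/h|/m_max]; by apply: entails_thm_mp; tautology.
Qed.

Section MCS.

Variable m : form -> Prop.
Hypothesis mcs_m : mcs m.

Lemma mcs_thm_mp A B : derivable (Imp A B) -> m A -> m B.
Proof. by case: mcs_m => thm imp _ /thm/imp. Qed.

Lemma mcs_Neg A : m (Neg A) <-> ~ m A.
Proof.
case: mcs_m => _ imp nBot.
by split=> [/imp h /h|nA]; [|apply/imp => /nA].
Qed.

Lemma mcs_And A B : m (And A B) <-> m A /\ m B.
Proof.
case: mcs_m => _ imp _; rewrite mcs_Neg imp mcs_Neg.
split=> [h|[hA hB] h]; last exact: h.
by split; apply: contrapT => hn; apply: h => // ? ?; apply: hn.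
Qed.

Lemma mcs_Conj (I : eqType) (g : I -> form) i s :
  m (Conj (g i) (map g s)) <-> forall k, k \in i :: s -> m (g k).
Proof.
elim: s i => [|j s IHs] i /=.
  by split=> [h k|]; [rewrite mem_seq1 => /eqP->|apply; rewrite mem_head].
rewrite mcs_And IHs; split=> [[hi hs] k|h].
  by rewrite inE => /orP[/eqP->|/hs].
by split=> [|k k_in]; apply: h; rewrite inE ?eqxx ?k_in ?orbT.
Qed.

End MCS.

(** * S5 modalities and canonical accessibility *)

Definition normal M : Prop :=
  (forall A, S5_axiom M A -> derivable A) /\
  (forall A, derivable A -> derivable (M A)).

Lemma normal_Box : normal (@Box Ag V).
Proof. split; [exact: ax_Box|exact: rule_Nec]. Qed.

Lemma normal_Stit j : normal (@Stit Ag V j).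
Proof.
split; first exact: ax_Stit.
by move=> A /rule_Nec; apply: rule_MP; apply: ax_Box_Stit.
Qed.

(** The S5 form of the canonical relation, visibly an equivalence. *)
Definition accessible M m n : Prop := forall A, m (M A) <-> n (M A).

Lemma accessible_sym M m n : accessible M m n -> accessible M n m.
Proof. by move=> mn A; rewrite mn. Qed.

Lemma accessible_trans M m n k :
  accessible M m n -> accessible M n k -> accessible M m k.
Proof. by move=> mn nk A; rewrite mn nk. Qed.

Section Modality.

Variable M : form -> form.
Hypothesis normal_M : normal M.

Lemma mcs_T m A : mcs m -> m (M A) -> m A.
Proof.
by move=> mcs_m; apply: mcs_thm_mp => //; apply: (proj1 normal_M); constructor.
Qed.

Lemma mcs_modal_entails m A : mcs m -> entails (fun B => m (M B)) A -> m (M A).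
Proof.
move=> mcs_m; case: (mcs_m) (normal_M) => thm imp _ [ax nec].
elim=> {A} [//|A /nec/thm //|A B _ hAB _ hA].
suff /imp/(_ hAB)/imp : m (Imp (M (Imp A B)) (Imp (M A) (M B))) by apply.
by apply/thm/ax; constructor.
Qed.

(** By axiom 4 the usual one-way canonical inclusion preserves [M]-formulas, and by axiom 5 it
    reflects them. *)
Lemma accessible_sub m n :
  mcs m -> mcs n -> (forall A, m (M A) -> n A) -> accessible M m n.
Proof.
move=> mcs_m mcs_n sub A; have ax := proj1 normal_M; split=> [mA|nA].
  by apply: sub; apply: mcs_thm_mp mA => //; apply: ax; constructor.
apply: contrapT => /(mcs_Neg mcs_m) mNA.
have /sub/(mcs_Neg mcs_n) // : m (M (Neg (M A))).
by apply: mcs_thm_mp mNA => //; apply: ax; constructor.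
Qed.

Lemma accessible_extension m G :
  mcs m -> (exists D, G D) -> (forall C D, G C -> G D -> G (And C D)) ->
  (forall D, G D -> ~ m (M (Neg D))) ->
  exists n, [/\ mcs n, accessible M m n & forall A, G A -> n A].
Proof.
move=> mcs_m exG closed consG.
have [|n mcs_n sub] := @Lindenbaum (fun A => m (M A) \/ G A).
  move=> /(entails_split exG closed)[D /consG nD].
  exact: (fun h => nD (mcs_modal_entails mcs_m h)).
exists n; split=> // [|A GA]; last by apply: sub; right.
by apply: accessible_sub => // A mA; apply: sub; left.
Qed.

Lemma accessible_witness m A :
  mcs m -> ~ m (M A) -> exists n, [/\ mcs n, accessible M m n & ~ n A].
Proof.
move=> mcs_m nA.
have [||D hD|n [mcs_n mn sub]] :=
    @accessible_extension m (fun D => derivable (Imp (Neg A) D)) mcs_m.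
- by exists (Neg A); tautology.
- by move=> C D hC hD; apply: rule_MP hD; apply: rule_MP hC; tautology.
- move=> mND; apply: nA; apply: mcs_modal_entails => //.
  apply: (@entails_thm_mp _ (Neg D)); last exact: entails_hyp.
  by apply: rule_MP hD; tautology.
- exists n; split=> //; apply/(mcs_Neg mcs_n); apply: sub.
  tautology.
Qed.

End Modality.

Lemma Stit_accessible_Box j m n :
  mcs m -> mcs n -> accessible (Stit j) m n -> accessible Box m n.
Proof.
move=> mcs_m mcs_n mn; apply: accessible_sub => // [|A mA]; first exact: normal_Box.
apply: (mcs_T (normal_Stit j)) => //; apply/mn.
by apply: mcs_thm_mp mA => //; apply: ax_Box_Stit.
Qed.

(** * Agreement on a sublanguage as a bisimulation; canonical independence *)

Section Agreement.

Variables (X : {set Ag}) (P : V -> Prop).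

Definition agree m n : Prop := forall A, in_lang X P A -> (m A <-> n A).

Lemma agree_sym m n : agree m n -> agree n m.
Proof. by move=> mn A /mn->. Qed.

(** The sublanguage part of [m'] is compatible with [n]: were [M (Neg D)] in [n], agreement would
    put it in [m], hence [Neg D] in [m']. Closure of the sublanguage under [M] is essential. *)
Lemma agree_zigzag M m m' n :
  normal M -> (forall A, in_lang X P A -> in_lang X P (M A)) ->
  mcs m -> mcs m' -> mcs n -> agree m n -> accessible M m m' ->
  exists n', [/\ mcs n', accessible M n n' & agree m' n'].
Proof.
move=> normal_M langM mcs_m mcs_m' mcs_n mn mm'.
have [|||n' [mcs_n' nn' sub]] :=
    @accessible_extension M normal_M n (fun D => in_lang X P D /\ m' D) mcs_n.
- exists (Imp Bot Bot); split=> //; case: mcs_m' => thm _ _; apply: thm.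
  tautology.
- by move=> C D [LC mC] [LD mD]; split=> //; apply/mcs_And.
- move=> D [LD mD] nND; have /(mcs_Neg mcs_m') // : m' (Neg D).
  by apply: (mcs_T normal_M) => //; apply/mm'/mn => //; apply: langM.
- exists n'; split=> // A LA; split=> [mA|nA]; first exact: sub.
  apply: contrapT => /(mcs_Neg mcs_m') mNA.
  by have /(mcs_Neg mcs_n') : n' (Neg A) by apply: sub.
Qed.

End Agreement.

(** A contradiction among the stit formulas of the [w j] uses finitely many, which merge into one
    per agent; the independence axiom realizes these together. *)
Lemma canonical_indep (j0 : Ag) m (w : Ag -> form -> Prop) :
  mcs m -> (forall j, mcs (w j)) -> (forall j, accessible Box m (w j)) ->
  exists n, mcs n /\ forall j, accessible (Stit j) (w j) n.
Proof.
move=> mcs_m mcs_w mw.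
pose G A := exists j, w j (Stit j A).
have [|n mcs_n sub] := @Lindenbaum G; last first.
  exists n; split=> // j; apply: accessible_sub => //; first exact: normal_Stit.
  by move=> A wA; apply: sub; exists j.
have choose A : entails G A -> exists2 f : Ag -> form,
    (forall j, w j (Stit j (f j))) &
    entails (fun B => exists j, B = Stit j (f j)) A.
  have top j : w j (Stit j (Imp Bot Bot)).
    case: (mcs_w j) => thm _ _; apply: thm; apply: (proj2 (normal_Stit j)).
    tautology.
  elim=> {A} [A [j wA]|A hA|A B _ [f wf hAB] _ [g wg hA]].
  - exists (fun k => if k == j then A else Imp Bot Bot) => [k|].
      by case: eqP => [->|_]; [exact: wA|exact: top].
    apply: (@entails_thm_mp _ (Stit j A)).
      by apply: ax_Stit; constructor.
    by apply: entails_hyp; exists j; rewrite eqxx.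
  - by exists (fun=> Imp Bot Bot) => //; apply: entails_thm.
  (* Passing to conjunctions strengthens the chosen formulas, so both derivations survive. *)
  - have trans (h : Ag -> form) C :
        (forall j, derivable (Imp (And (f j) (g j)) (h j))) ->
        entails (fun B => exists j, B = Stit j (h j)) C ->
        entails (fun B => exists j, B = Stit j (And (f j) (g j))) C.
      move=> hsub; elim=> {C} [_ [j ->]|C hC|C D _ hCD _]; last exact: entails_mp.
        apply: (@entails_thm_mp _ (Stit j (And (f j) (g j)))).
          apply: rule_MP (proj2 (normal_Stit j) _ (hsub j)).
          by apply: (ax_Stit (j := j)); constructor.
        by apply: entails_hyp; exists j.
      exact: entails_thm.
    exists (fun j => And (f j) (g j)) => [j|].
      apply: (mcs_modal_entails (normal_Stit j)) => //.
      apply: (@entails_mp _ (g j)); last exact: entails_hyp.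
      apply: (@entails_mp _ (f j)); last exact: entails_hyp.
      by apply: entails_thm; tautology.
    by apply: entails_mp (trans _ _ _ hAB) (trans _ _ _ hA) => j; tautology.
move=> /choose[f wf hBot].
(* The independence axiom is stated for a nonempty list; [j0] guarantees one. *)
have [i [s enum_is]] : exists i s, enum Ag = i :: s.
  by case: (enum Ag) (mem_enum Ag j0) => // i s _; exists i, s.
have mem_is k : k \in i :: s by rewrite -enum_is mem_enum.
have uniq_is : uniq (i :: s) by rewrite -enum_is enum_uniq.
pose g j := Stit j (f j).
have Dia_witness A : m (Dia A) <-> exists u, [/\ mcs u, accessible Box m u & u A].
  rewrite mcs_Neg //; split=> [/(accessible_witness normal_Box mcs_m)|].
    case=> u [mcs_u mu nuA]; exists u; split=> //.
    by apply: contrapT => /(mcs_Neg mcs_u).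
  case=> u [mcs_u mu uA] /mu/(mcs_T normal_Box mcs_u).
  by move=> /(mcs_Neg mcs_u).
have : m (Dia (Conj (g i) (map g s))).
  have := @ax_indep Ag V (i, f i) [seq (j, f j) | j <- s].
  rewrite /= -!map_comp /comp /= map_id => /(_ uniq_is).
  move=> /(mcs_thm_mp mcs_m); apply.
  apply/(mcs_Conj mcs_m (fun j => Dia (g j))) => k _.
  by apply/Dia_witness; exists (w k); split.
case/Dia_witness=> u [mcs_u _ /(mcs_Conj mcs_u) ug].
have [_ _ nBot] := mcs_u; apply: nBot.
elim: hBot => [_ [j ->]|A hA|A B _ uAB _ uA].
- exact: ug.
- by case: mcs_u => thm _ _; apply: thm.
- by case: mcs_u => _ imp _; move/imp: uAB; apply.
Qed.

End Canonical.

(** * The amalgamated model of agreeing pairs *)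

Section Amalgamation.

Variables (Ag : finType) (V : Type) (j0 : Ag) (X Y : {set Ag}) (P Q : V -> Prop).
Hypotheses (card_X : #|X| <= 1) (disjoint_XY : [disjoint X & Y]).
Local Notation form := (form Ag V).
Local Notation agree := (agree X (fun p => P p /\ Q p)).

Variables w v : form -> Prop.
Hypotheses (mcs_w : mcs w) (mcs_v : mcs v) (agree_wv : agree w v).

Record world := World {
  fst_mcs : form -> Prop;
  snd_mcs : form -> Prop;
  fst_mcsP : mcs fst_mcs;
  snd_mcsP : mcs snd_mcs;
  world_agree : agree fst_mcs snd_mcs;
  fst_Box : accessible Box w fst_mcs;
  snd_Box : accessible Box v snd_mcs }.

Definition world_rel (j : Ag) (k k' : world) : Prop :=
  if j \in X then accessible (Stit j) (fst_mcs k) (fst_mcs k')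
  else accessible (Stit j) (snd_mcs k) (snd_mcs k').

(** The disjunction is unambiguous: on a variable in both [P] and [Q] the two components agree. *)
Definition world_val (p : V) (k : world) : Prop :=
  (P p /\ fst_mcs k (Var p)) \/ (Q p /\ snd_mcs k (Var p)).

(** Zigzag for [Box] supplies the missing second component, so canonical witnesses become worlds. *)
Lemma world_extend_fst (k : world) m :
  mcs m -> accessible Box (fst_mcs k) m -> exists k', fst_mcs k' = m.
Proof.
move=> mcs_m km; have wm := accessible_trans (fst_Box k) km.
have [//|n [mcs_n kn mn]] := agree_zigzag (normal_Box Ag V) _
  (fst_mcsP k) mcs_m (snd_mcsP k) (@world_agree k) km.
by exists (World mcs_m mcs_n mn wm (accessible_trans (snd_Box k) kn)).
Qed.

Lemma world_extend_snd (k : world) n :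
  mcs n -> accessible Box (snd_mcs k) n -> exists k', snd_mcs k' = n.
Proof.
move=> mcs_n kn; have vn := accessible_trans (snd_Box k) kn.
have [//|m [mcs_m km nm]] := agree_zigzag (normal_Box Ag V) _
  (snd_mcsP k) mcs_n (fst_mcsP k) (agree_sym (@world_agree k)) kn.
by exists (World mcs_m mcs_n (agree_sym nm) (accessible_trans (fst_Box k) km) vn).
Qed.

(** Canonical independence for all agents gives the second component [n]; zigzag along the single
    agent [x] of [X] then gives a first component reached from that of [f x]. *)
Lemma world_rel_indep (f : Ag -> world) :
  exists k, forall j, world_rel j (f j) k.
Proof.
have [||n [mcs_n fn]] := @canonical_indep Ag V j0 v (fun j => snd_mcs (f j)) mcs_v.
- by move=> j; apply: snd_mcsP.
- by move=> j; apply: snd_Box.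
have Box_n j : accessible Box (snd_mcs (f j)) n.
  exact: (Stit_accessible_Box (snd_mcsP _) mcs_n (fn j)).
case: (set_0Vmem X) => [X0|[x xX]].
  (* Every agent acts through second components, so any completion of [n] works. *)
  have [k kn] := world_extend_snd mcs_n (Box_n j0).
  by exists k => j; rewrite /world_rel X0 inE kn.
have X1 j : j \in X -> j = x by move=> jX; apply: (card_le1_eqP card_X).
have [A LA|m [mcs_m xm nm]] := agree_zigzag (normal_Stit V x) _ (snd_mcsP (f x))
  mcs_n (fst_mcsP (f x)) (agree_sym (@world_agree (f x))) (fn x); first by [].
have wm := accessible_trans (fst_Box (f x))
  (Stit_accessible_Box (fst_mcsP _) mcs_m xm).
exists (World mcs_m mcs_n (agree_sym nm) wm
          (accessible_trans (snd_Box (f x)) (Box_n x))) => j.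
by rewrite /world_rel /=; case: ifP => [/X1->|_]; [exact: xm|exact: fn].
Qed.

(** Agents of [X] ignore second components, so a witness for [Stit j] may be completed arbitrarily;
    a completion exists because a [Stit j] step is also a [Box] step. *)
Lemma truth_fst A k : in_lang X P A -> sat world_rel world_val A k <-> fst_mcs k A.
Proof.
elim: A k => [p|A IHA B IHB||A IHA|j A IHA] k /=.
- move=> Pp; split=> [[[] //|[Qp kp]]|kp]; last by left.
  exact/(@world_agree k).
- move=> [LA LB]; have [_ imp _] := fst_mcsP k.
  by rewrite imp IHA // IHB.
- by move=> _; split=> //; case: (fst_mcsP k).
- move=> LA; split=> [h|kA k'].
    apply: contrapT => /(accessible_witness (normal_Box Ag V) (fst_mcsP k)).
    case=> m [mcs_m km]; have [k' <-] := world_extend_fst mcs_m km.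
    by rewrite -IHA.
  apply/IHA => //; apply: (mcs_T (normal_Box Ag V) (fst_mcsP k')).
  by apply/(fst_Box k')/(fst_Box k).
- move=> [jX LA]; rewrite /world_rel jX; split=> [h|kA k' kk'].
    apply: contrapT => /(accessible_witness (normal_Stit V j) (fst_mcsP k)).
    case=> m [mcs_m km].
    have := Stit_accessible_Box (fst_mcsP k) mcs_m km.
    move=> /(world_extend_fst mcs_m)[k' def_m]; rewrite -def_m in km *.
    by rewrite -IHA //; apply; apply: h.
  apply/IHA => //; apply: (mcs_T (normal_Stit V j) (fst_mcsP k')).
  exact/kk'.
Qed.

(** The mirror image; disjointness sends the agents of [Y] through second components. *)
Lemma truth_snd A k : in_lang Y Q A -> sat world_rel world_val A k <-> snd_mcs k A.
Proof.
elim: A k => [p|A IHA B IHB||A IHA|j A IHA] k /=.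
- move=> Qp; split=> [[[Pp kp]|[] //]|kp]; last by right.
  exact/(@world_agree k).
- move=> [LA LB]; have [_ imp _] := snd_mcsP k.
  by rewrite imp IHA // IHB.
- by move=> _; split=> //; case: (snd_mcsP k).
- move=> LA; split=> [h|kA k'].
    apply: contrapT => /(accessible_witness (normal_Box Ag V) (snd_mcsP k)).
    case=> m [mcs_m km]; have [k' <-] := world_extend_snd mcs_m km.
    by rewrite -IHA.
  apply/IHA => //; apply: (mcs_T (normal_Box Ag V) (snd_mcsP k')).
  by apply/(snd_Box k')/(snd_Box k).
- move=> [jY LA]; rewrite /world_rel (disjointFl disjoint_XY jY).
  split=> [h|kA k' kk'].
    apply: contrapT => /(accessible_witness (normal_Stit V j) (snd_mcsP k)).
    case=> m [mcs_m km].
    have := Stit_accessible_Box (snd_mcsP k) mcs_m km.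
    move=> /(world_extend_snd mcs_m)[k' def_m]; rewrite -def_m in km *.
    by rewrite -IHA //; apply; apply: h.
  apply/IHA => //; apply: (mcs_T (normal_Stit V j) (snd_mcsP k')).
  exact/kk'.
Qed.

Lemma amalgamation A B :
  derivable (Imp A B) -> in_lang X P A -> in_lang Y Q B -> w A -> v B.
Proof.
move=> AB LA LB wA.
have Box_refl (m : form -> Prop) : accessible Box m m by [].
pose k := World mcs_w mcs_v agree_wv (Box_refl w) (Box_refl v).
apply/(truth_snd k LB).
have rel_refl j k1 : world_rel j k1 k1 by rewrite /world_rel; case: ifP.
have rel_sym j k1 k2 : world_rel j k1 k2 -> world_rel j k2 k1.
  by rewrite /world_rel; case: ifP => _; apply: accessible_sym.
have rel_trans j k1 k2 k3 :
    world_rel j k1 k2 -> world_rel j k2 k3 -> world_rel j k1 k3.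
  by rewrite /world_rel; case: ifP => _; apply: accessible_trans.
have /= := soundness world_val rel_refl rel_sym rel_trans world_rel_indep AB k.
by apply; apply/truth_fst.
Qed.

End Amalgamation.

(** * From amalgamation to interpolants *)

Section Interpolation.

Variables (Ag : finType) (V : Type).
Implicit Types A B C : form Ag V.

Lemma in_lang_mono (X X' : {set Ag}) (P P' : V -> Prop) A :
  {subset X <= X'} -> (forall p, P p -> P' p) ->
  in_lang X P A -> in_lang X' P' A.
Proof.
move=> sX sP; elim: A => [p|A IHA B IHB||A IHA|j A IHA] //=.
- exact: sP.
- by case=> /IHA ? /IHB.
- by case=> /sX ? /IHA.
Qed.

Lemma in_lang_self A : in_lang (agents A) (vars A) A.
Proof.
elim: A => [p|A IHA B IHB||A IHA|j A IHA] //=.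
- split; [apply: in_lang_mono IHA|apply: in_lang_mono IHB].
  + by move=> k k_in; rewrite inE k_in.
  + by left.
  + by move=> k k_in; rewrite inE k_in orbT.
  + by right.
- split; first by rewrite !inE eqxx.
  by apply: in_lang_mono IHA => // k k_in; rewrite inE k_in orbT.
Qed.

Lemma interpolation_one_agent (j0 : Ag) A B :
  #|agents A| <= 1 -> [disjoint agents A & agents B] -> derivable (Imp A B) ->
  exists C, [/\ in_lang (agents A) (fun p => vars A p /\ vars B p) C,
                derivable (Imp A C) & derivable (Imp C B)].
Proof.
move=> card_A disj AB; apply: contrapT => no_interpolant.
pose L := in_lang (agents A) (fun p => vars A p /\ vars B p).
(* [v] comes first and contains every consequence of [A] in [L]; if these refuted [Neg B], a
   conjunction of finitely many would be an interpolant. *)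
have [|v mcs_v sub_v] :=
    @Lindenbaum _ _ (fun C => Neg B = C \/ (L C /\ derivable (Imp A C))).
  case/entails_split => [||D [LD AD] /deduction BD].
  - by exists (Imp Bot Bot); split=> //; tautology.
  - move=> C D [LC AC] [LD AD]; split=> //.
    by apply: rule_MP AD; apply: rule_MP AC; tautology.
  - apply: no_interpolant; exists D; split=> //.
    by apply: rule_MP BD; tautology.
(* If [A] refuted some [D] of [L] in [v], then [Neg D] would be a consequence of [A] in [L], hence
   already in [v]. *)
have [|w mcs_w sub_w] := @Lindenbaum _ _ (fun C => A = C \/ (L C /\ v C)).
  case/entails_split => [||D [LD vD] /deduction AD].
  - exists (Imp Bot Bot); split=> //; case: mcs_v => thm _ _; apply: thm.
    tautology.
  - by move=> C D [LC vC] [LD vD]; split=> //; apply/mcs_And.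
  - have /(mcs_Neg mcs_v) // : v (Neg D) by apply: sub_v; right.
have agree_wv : agree (agents A) (fun p => vars A p /\ vars B p) w v.
  move=> C LC; split=> [wC|vC]; last by apply: sub_w; right.
  (* Closure of [L] under negation turns the one-way inclusion into agreement. *)
  apply: contrapT => /(mcs_Neg mcs_v) vNC.
  by have /(mcs_Neg mcs_w) : w (Neg C) by apply: sub_w; right.
have /(mcs_Neg mcs_v) : v (Neg B) by apply: sub_v; left.
apply; apply: (amalgamation j0 card_A disj mcs_w mcs_v agree_wv AB).
- exact: in_lang_self.
- exact: in_lang_self.
- by apply: sub_w; left.
Qed.

End Interpolation.

Theorem theorem1 (n : nat) (n_pos : 0 < n) (n_le3 : n <= 3) : RCIP n.
Proof.
move=> V A B AB AB0.
have disj : [disjoint agents A & agents B] by rewrite -setI_eq0; apply/eqP.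
have j0 := Ordinal n_pos.
have [card_A|card_A] := leqP #|agents A| 1.
  have [C [LC AC CB]] := interpolation_one_agent j0 card_A disj AB.
  by exists C; split=> //; apply: in_lang_mono LC => // j j_in; rewrite inE j_in.
(* At least two of at most three agents occur in [A], leaving at most one for [B]. *)
have card_B : #|agents B| <= 1.
  have := leq_trans (max_card (agents A :|: agents B)) (eq_leq (card_ord n)).
  rewrite cardsU AB0 cards0 subn0 => /leq_trans/(_ n_le3) le3.
  by rewrite -(leq_add2l 2); apply: leq_trans le3; rewrite leq_add2r.
(* Contraposition swaps the roles of [A] and [B]; the interpolant is then negated. *)
have [|||C [LC BC CA]] := @interpolation_one_agent _ V j0 (Neg B) (Neg A).
- by rewrite /= setU0.
- by rewrite /= !setU0 disjoint_sym.
- by apply: rule_MP AB; tautology.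
exists (Neg C); split.
- split=> //; apply: in_lang_mono LC => [j|p /= [[] // ? [] //]].
  by rewrite /= setU0 inE => ->; rewrite orbT.
- by apply: rule_MP CA; tautology.
- by apply: rule_MP BC; tautology.
Qed.
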